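(* Let $F$ be an algebraically closed field of characteristic $0$, let $n\ge2$, $\Omega=\{1,\dots,n\}$, and let $\mathfrak{A}$ be the universal associative envelope of the anti-Jordan triple system of all $n\times n$ matrices over $F$, with generators $e_{i,j}$. For all $i,j,k,\ell\in\Omega$ the following identities hold in $\mathfrak{A}$. (1) $$e_{1,1}^2e_{1,k}\cdot e_{i,j}=\delta_{k,i}\Big[\delta_{j,1}\Big(\big(\delta_{k,1}+\tfrac12\widehat\delta_{k,1}\big)e_{1,1}^4+\tfrac12\widehat\delta_{k,1}e_{1,1}^2\Big)+\widehat\delta_{j,1}e_{1,1}e_{1,j}\Big]-\widehat\delta_{k,i}\delta_{j,1}\delta_{k,1}e_{1,1}e_{i,1}.$$ (2) $$\begin{aligned}e_{1,1}^2e_{1,k}\cdot e_{i,1}e_{1,j}=\;&\Big[\delta_{k,i}\delta_{j,1}\big(\delta_{k,1}+\tfrac12\widehat\delta_{k,1}\big)+\tfrac12\widehat\delta_{k,i}\delta_{k,1}\widehat\delta_{i,1}\delta_{i,j}\Big]e_{1,1}+\tfrac12\Big(\delta_{k,i}\widehat\delta_{k,1}\delta_{j,1}-\widehat\delta_{k,i}\delta_{k,1}\widehat\delta_{i,1}\delta_{i,j}\Big)e_{1,1}^3\\&+\Big(\delta_{k,1}\big(\delta_{k,i}\widehat\delta_{j,1}-\widehat\delta_{k,i}\delta_{i,1}\big)+\delta_{k,i}\widehat\delta_{k,1}\widehat\delta_{j,1}\Big)e_{1,1}^2e_{1,j}.\end{aligned}$$ (3) If $(i,j)\ne(1,1)$: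 $\;e_{1,1}^2e_{1,k}\cdot e_{1,i}e_{j,1}=\delta_{k,1}\Big(-\delta_{i,1}e_{1,1}^2e_{j,1}+\widehat\delta_{i,1}\delta_{i,j}\tfrac12(e_{1,1}^3+e_{1,1})\Big).$ (4) If $\ell\ne1$: $\;e_{1,1}^2e_{1,k}\cdot e_{1,j}e_{1,1}e_{\ell,1}=\delta_{k,1}\delta_{j,1}e_{1,1}e_{\ell,1}.$ (5) $e_{1,1}^2e_{1,k}\cdot e_{1,1}^2e_{1,j}=\delta_{k,1}e_{1,1}e_{1,j}.$ (6) $e_{1,1}^2e_{1,j}\cdot e_{1,1}^4=\delta_{j,1}e_{1,1}^3.$
   Context: $\delta_{i,j}$ is the Kronecker delta and $\widehat\delta_{i,j}=1-\delta_{i,j}$. The anti-Jordan triple system of all $n\times n$ matrices over $F$ has trilinear product $\langle a,b,c\rangle=abc-cba$. Its universal associative envelope is $\mathfrak{A}=F\langle X\rangle/I$, where $F\langle X\rangle$ is the free unital associative algebra on symbols $X=\{e_{i,j}\}_{i,j\in\Omega}$ (with $e_{i,j}$ corresponding to the matrix unit $E_{i,j}$), and $I$ is the two-sided ideal generated by all elements $e_{i,j}e_{k,\ell}e_{m,t}-e_{m,t}e_{k,\ell}e_{i,j}-\delta_{j,k}\delta_{\ell,m}e_{i,t}+\delta_{t,k}\delta_{\ell,i}e_{m,j}$ for $i,j,k,\ell,m,t\in\Omega$. The image of $e_{i,j}$ in $\mathfrak{A}$ is again denoted $e_{i,j}$. *)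

(* Defs.v *)
From HB Require Import structures.
From mathcomp Require Import all_boot all_order all_algebra.
From mathcomp Require Import monalg boolp.

Set Implicit Arguments.
Unset Strict Implicit.
Unset Printing Implicit Defensive.

Import GRing.Theory.
Local Open Scope ring_scope.
Local Open Scope quotient_scope.

Inductive two_sided_ideal (A : nzRingType) (S : A -> Prop) : A -> Prop :=
| tsi_gen u of S u : two_sided_ideal S u
| tsi_0 : two_sided_ideal S 0
| tsi_add u v of two_sided_ideal S u & two_sided_ideal S v :
    two_sided_ideal S (u + v)
| tsi_mull a u of two_sided_ideal S u : two_sided_ideal S (a * u)
| tsi_mulr a u of two_sided_ideal S u : two_sided_ideal S (u * a).

Lemma tsi_rmorph0 (A B : nzRingType) (f : {rmorphism A -> B}) (S : A -> Prop) :
  (forall u, S u -> f u = 0) -> forall u, two_sided_ideal S u -> f u = 0.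
Proof.
move=> S0 u; elim=> [v /S0//||v w _ v0 _ w0|a v _ v0|a v _ v0].
- exact: rmorph0.
- by rewrite rmorphD v0 w0 addr0.
- by rewrite rmorphM v0 mulr0.
- by rewrite rmorphM v0 mul0r.
Qed.

(* The quotient of an algebra by the two-sided ideal generated by S.
   Quotient.quot is the quotient as an additive group; ring_quotient gives it a
   product only when the ring is commutative.  The operations are locked to keep
   unification out of the representatives. *)
Section QuotientAlgebra.
Variables (F : fieldType) (A : algType F) (S : A -> Prop).

Definition tsi_pred : pred A := fun u => `[< two_sided_ideal S u >].

Lemma tsi_predP u : reflect (two_sided_ideal S u) (u \in tsi_pred).
Proof. exact: asboolP. Qed.

Lemma tsi_pred_mull a u : u \in tsi_pred -> a * u \in tsi_pred.
Proof. by move=> /tsi_predP Iu; apply/tsi_predP/tsi_mull. Qed.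

Lemma tsi_pred_mulr a u : u \in tsi_pred -> u * a \in tsi_pred.
Proof. by move=> /tsi_predP Iu; apply/tsi_predP/tsi_mulr. Qed.

Lemma tsi_pred_zmod_closed : zmod_closed tsi_pred.
Proof.
split=> [|u v Iu Iv]; first by apply/tsi_predP/tsi_0.
apply/tsi_predP/tsi_add; apply/tsi_predP => //.
by rewrite -mulN1r; apply: tsi_pred_mull.
Qed.

HB.instance Definition _ :=
  GRing.isZmodClosed.Build A tsi_pred tsi_pred_zmod_closed.

Hypothesis S_proper : ~ two_sided_ideal S 1.

Definition quot_alg of ~ two_sided_ideal S 1 : Type :=
  Quotient.quot (GRing.ZmodClosed.clone A tsi_pred _).

Local Notation Q := (quot_alg S_proper).

HB.instance Definition _ := GRing.Zmodule.on Q.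
HB.instance Definition _ := EqQuotient.on Q.

Definition qa_pi (u : A) : Q := \pi_Q u.
Definition qa_one : Q := lift_cst Q 1.
Definition qa_mul : Q -> Q -> Q := lift_op2 Q *%R.
Definition qa_scale : F -> Q -> Q := locked (fun c a => \pi_Q (c *: repr a)).

Lemma qa_reprK (a : Q) : qa_pi (repr a) = a.
Proof. exact: reprK. Qed.

Lemma qa_pi_eq u v : (qa_pi u == qa_pi v) = (u - v \in tsi_pred).
Proof. by rewrite Quotient.idealrBE. Qed.

Lemma qa_pi_subrK u : u - repr (qa_pi u) \in tsi_pred.
Proof. by rewrite -qa_pi_eq qa_reprK. Qed.

Lemma qa_pi0 : qa_pi 0 = 0. Proof. exact: pi_zeror. Qed.

Lemma qa_piD u v : qa_pi (u + v) = qa_pi u + qa_pi v.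
Proof. exact: pi_addr. Qed.

Lemma qa_pi1 : qa_pi 1 = qa_one.
Proof. by rewrite /qa_one; unlock. Qed.

Lemma qa_piM u v : qa_pi (u * v) = qa_mul (qa_pi u) (qa_pi v).
Proof.
rewrite /qa_mul; unlock; apply/eqP; rewrite qa_pi_eq.
rewrite -[u * v](addrNK (repr (qa_pi u) * v)) -mulrBl -addrA -mulrBr.
apply: rpredD; first by apply: tsi_pred_mulr; apply: qa_pi_subrK.
by apply: tsi_pred_mull; apply: qa_pi_subrK.
Qed.

Lemma qa_piZ c u : qa_pi (c *: u) = qa_scale c (qa_pi u).
Proof.
rewrite /qa_scale -lock; apply/eqP; rewrite qa_pi_eq -scalerBr -mulr_algl.
by apply: tsi_pred_mull; apply: qa_pi_subrK.
Qed.

Lemma qa_mulA : associative qa_mul.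
Proof.
move=> a b c; rewrite -[a]qa_reprK -[b]qa_reprK -[c]qa_reprK.
by rewrite -!qa_piM mulrA.
Qed.

Lemma qa_mul1 : left_id qa_one qa_mul.
Proof. by move=> a; rewrite -[a]qa_reprK -qa_pi1 -qa_piM mul1r. Qed.

Lemma qa_mulr1 : right_id qa_one qa_mul.
Proof. by move=> a; rewrite -[a]qa_reprK -qa_pi1 -qa_piM mulr1. Qed.

Lemma qa_mulDl : left_distributive qa_mul +%R.
Proof.
move=> a b c; rewrite -[a]qa_reprK -[b]qa_reprK -[c]qa_reprK.
by rewrite -qa_piD -!qa_piM -qa_piD mulrDl.
Qed.

Lemma qa_mulDr : right_distributive qa_mul +%R.
Proof.
move=> a b c; rewrite -[a]qa_reprK -[b]qa_reprK -[c]qa_reprK.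
by rewrite -qa_piD -!qa_piM -qa_piD mulrDr.
Qed.

Lemma qa_one_neq0 : qa_one != 0.
Proof.
by rewrite -qa_pi1 -qa_pi0 qa_pi_eq subr0; apply/negP => /tsi_predP /S_proper.
Qed.

HB.instance Definition _ := GRing.Zmodule_isNzRing.Build Q
  qa_mulA qa_mul1 qa_mulr1 qa_mulDl qa_mulDr qa_one_neq0.

Lemma qa_scaleA b c a : qa_scale b (qa_scale c a) = qa_scale (b * c) a.
Proof. by rewrite -[a]qa_reprK -!qa_piZ scalerA. Qed.

Lemma qa_scale1 : left_id 1 qa_scale.
Proof. by move=> a; rewrite -[a]qa_reprK -qa_piZ scale1r. Qed.

Lemma qa_scaleDr : right_distributive qa_scale +%R.
Proof.
move=> c a b; rewrite -[a]qa_reprK -[b]qa_reprK.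
by rewrite -qa_piD -!qa_piZ -qa_piD scalerDr.
Qed.

Lemma qa_scaleDl a : {morph qa_scale^~ a : b c / b + c}.
Proof. by move=> b c; rewrite -[a]qa_reprK -!qa_piZ -qa_piD scalerDl. Qed.

HB.instance Definition _ := GRing.Zmodule_isLmodule.Build F Q
  qa_scaleA qa_scale1 qa_scaleDr qa_scaleDl.

Lemma qa_scaleAl c (a b : Q) : c *: (a * b) = c *: a * b.
Proof.
change (qa_scale c (qa_mul a b) = qa_mul (qa_scale c a) b).
rewrite -[a]qa_reprK -[b]qa_reprK.
by rewrite -qa_piM -!qa_piZ -qa_piM scalerAl.
Qed.

HB.instance Definition _ := GRing.Lmodule_isLalgebra.Build F Q qa_scaleAl.

Lemma qa_scaleAr c (a b : Q) : c *: (a * b) = a * (c *: b).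
Proof.
change (qa_scale c (qa_mul a b) = qa_mul a (qa_scale c b)).
rewrite -[a]qa_reprK -[b]qa_reprK.
by rewrite -qa_piM -!qa_piZ -qa_piM scalerAr.
Qed.

HB.instance Definition _ := GRing.Lalgebra_isAlgebra.Build F Q qa_scaleAr.

Lemma qa_pi_is_linear : linear qa_pi.
Proof. by move=> c u v; rewrite qa_piD qa_piZ. Qed.

HB.instance Definition _ :=
  GRing.isLinear.Build F A Q *:%R qa_pi qa_pi_is_linear.

Lemma qa_pi_is_monoid_morphism : monoid_morphism qa_pi.
Proof. by split=> [|u v]; [rewrite qa_pi1 | rewrite qa_piM]. Qed.

HB.instance Definition _ :=
  GRing.isMonoidMorphism.Build A Q qa_pi qa_pi_is_monoid_morphism.

Lemma qa_pi_gen u : S u -> qa_pi u = 0.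
Proof.
move=> Su; apply/eqP; rewrite -qa_pi0 qa_pi_eq subr0.
exact/tsi_predP/tsi_gen.
Qed.

End QuotientAlgebra.

(* Omega = {1, ..., n} is 'I_n: the index i of the text is the ordinal i - 1, so
   its index 1 is the ordinal 0. *)
Definition idx1 (n : nat) (hn : (2 <= n)%N) : 'I_n := Ordinal (ltnW hn).

Definition kd (F : nzRingType) (I : eqType) (i j : I) : F := (i == j)%:R.
Definition kdc (F : nzRingType) (I : eqType) (i j : I) : F := 1 - kd F i j.

(* abc - cba on n x n matrices; its values on matrix units give the linear terms
   of ajts_rel below. *)
Definition ajts (F : fieldType) (n : nat) (a b c : 'M[F]_n) : 'M[F]_n :=
  a *m b *m c - c *m b *m a.

Lemma ajts_delta (F : fieldType) (n : nat) (i j k l m t : 'I_n) :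
  ajts (delta_mx i j) (delta_mx k l) (delta_mx m t) =
  (kd F j k * kd F l m) *: delta_mx i t - (kd F t k * kd F l i) *: delta_mx m j.
Proof.
have E3 (a b c d p q : 'I_n) :
    delta_mx a b *m delta_mx c d *m delta_mx p q =
    (kd F b c * kd F d p) *: delta_mx a q.
  rewrite mul_delta_mx_cond /kd; case: (b == c); rewrite ?mulr0n ?mulr1n.
    rewrite mul_delta_mx_cond mul1r.
    by case: (d == p); rewrite ?mulr0n ?mulr1n (scale0r, scale1r).
  by rewrite mul0mx mul0r scale0r.
by rewrite /ajts (E3 i j k l m t) (E3 m t k l i j).
Qed.

Section Relations.
Variables (F : fieldType) (n : nat) (A : algType F) (x : 'I_n -> 'I_n -> A).

Definition ajts_rel (i j k l m t : 'I_n) : A :=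
  x i j * x k l * x m t - x m t * x k l * x i j
  - (kd F j k * kd F l m) *: x i t + (kd F t k * kd F l i) *: x m j.

Definition ajts_rels (u : A) : Prop :=
  exists i j k l m t : 'I_n, u = ajts_rel i j k l m t.

Lemma ajts_rel_rmorph0 (f : {rmorphism A -> F}) :
    (forall c u, f (c *: u) = c * f u) -> (forall i j, f (x i j) = 0) ->
  forall u, ajts_rels u -> f u = 0.
Proof.
move=> fZ fx _ [i [j [k [l [m [t ->]]]]]].
by rewrite /ajts_rel rmorphD !rmorphB !rmorphM !fZ !fx !mulr0 !subr0 addr0.
Qed.

End Relations.

Lemma ajts_rel_morph (F : fieldType) (n : nat) (A B : algType F)
    (f : {lrmorphism A -> B}) (x : 'I_n -> 'I_n -> A) (i j k l m t : 'I_n) :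
  f (ajts_rel x i j k l m t) = ajts_rel (fun p q => f (x p q)) i j k l m t.
Proof.
have fZ c u : f (c *: u) = c *: f u by exact: linearZ.
by rewrite /ajts_rel rmorphD !rmorphB !rmorphM /= !fZ.
Qed.

(* F<X>: the monoid algebra over F of the free monoid on X = {e_{i,j}}. *)
Definition free_alg (F : fieldType) (n : nat) : Type :=
  {malg F[{fmonom ('I_n * 'I_n)%type}]}.

Section FreeAlgebra.
Variables (F : fieldType) (n : nat).
Local Notation K := {fmonom ('I_n * 'I_n)%type}.

HB.instance Definition _ := GRing.Lalgebra.on (free_alg F n).

Lemma free_alg_scaleAr (c : F) (u v : free_alg F n) :
  c *: (u * v) = u * (c *: v).
Proof.
pose A := {malg F[K]}.
have mulC (g : A) : g * (c%:MP : A) = c *: g.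
  rewrite malgM_def malgZ_def /= fgmulgU.
  by apply: eq_bigr => /= k _; rewrite mulrC mulm1.
change (c *: ((u : A) * (v : A)) = (u : A) * (c *: (v : A))).
by rewrite -(mul_malgC c (v : A)) mulrA mulC -(mul_malgC c (u : A)) -mulrA
  mul_malgC.
Qed.

HB.instance Definition _ :=
  GRing.Lalgebra_isAlgebra.Build F (free_alg F n) free_alg_scaleAr.

Definition free_gen (i j : 'I_n) : free_alg F n :=
  (<< fmu (i, j) >> : {malg F[K]}).

Lemma free_alg_proper : ~ two_sided_ideal (ajts_rels free_gen) 1.
Proof.
pose aug : {rmorphism {malg F[K]} -> F} := @mcoeff K F (mone : K).
have augX i j : aug (free_gen i j) = 0.
  by rewrite /aug /= /free_gen mcoeffU1 fm1_eq1.
have augZ c u : aug (c *: u) = c * aug u by exact: mcoeffZ.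
move=> /(@tsi_rmorph0 _ _ aug) aug1.
have /eqP := aug1 (@ajts_rel_rmorph0 F n (free_alg F n) free_gen aug augZ augX).
by rewrite (rmorph1 aug) oner_eq0.
Qed.

End FreeAlgebra.

Definition envelope (F : fieldType) (n : nat) : algType F :=
  quot_alg (@free_alg_proper F n).

Definition env_gen (F : fieldType) (n : nat) (i j : 'I_n) : envelope F n :=
  qa_pi (@free_alg_proper F n) (free_gen F i j).

Lemma env_gen_rel (F : fieldType) (n : nat) (i j k l m t : 'I_n) :
  ajts_rel (@env_gen F n) i j k l m t = 0.
Proof.
rewrite -(ajts_rel_morph (qa_pi (@free_alg_proper F n))).
by apply: qa_pi_gen; exists i, j, k, l, m, t.
Qed.

(* Main.v *)
Require Import Defs.
From mathcomp Require Import all_boot all_order all_algebra.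

Set Implicit Arguments.
Unset Strict Implicit.
Unset Printing Implicit Defensive.

Import GRing.Theory.
Local Open Scope ring_scope.

(** Write E_ij for matrix units and e = e_11.  The envelope maps onto matrix
    algebras by a |-> c a with c^2 = 1 and by a |-> c a^T with c^2 = -1, and the
    six identities say what these maps predict: e_ij e_kl should depend only on
    the two products E_ij E_kl and E_kl E_ij, the even power e^4 should be +1 or
    -1 times e^2 according to whether the map preserves or reverses products, so
    that (e^4 + e^2) / 2 and (e^2 - e^4) / 2 separate the two kinds, and e^5
    should be e.

    These facts follow from the defining relations alone.  A relation reverses a
    product of three generators at the price of a linear term.  A product a b c d
    can be turned into c d a b by reversing first a b c or first b c d, and
    comparing the linear terms gives a quadratic relation (overlap).  Its
    instances on matrix units describe the products of two generators:
    e_ij e_kl = 0 when neither E_ij E_kl nor E_kl E_ij survives (mul_disjoint),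
    e_ij e_jl and e_ij e_ki depend only on the surviving matrix unit
    (mul_path_indep, mul_copath_indep), and mul_loops relates the remaining
    products e_ij e_ji.

    For k <> 1 put v = e e_1k e_k1 and w = e e_k1 e_1k.  Then v + w = e^3 by
    mul_loops and v - w = e by a reversal, which is where the halves come from.
    Since e^2 w = - w (corner3_col), substituting w = (e^3 - e) / 2 gives
    e^5 = e (corner5).  Every case of the six identities is then a short
    rewriting with these rules. *)

(** * Quadratic consequences of the reversal relations *)

Section ReversalRelations.

Variables (F : fieldType) (n : nat) (A : algType F) (x : 'I_n -> 'I_n -> A).

Definition reversal_defect (i j k l m t : 'I_n) : A :=
  x i t *+ ((j == k) && (l == m)) - x m j *+ ((t == k) && (l == i)).

Hypothesis relx : forall i j k l m t, ajts_rel x i j k l m t = 0.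
Hypothesis two_neq0 : 2%:R != 0 :> F.

Lemma mul_reverse i j k l m t :
  x i j * x k l * x m t =
  x m t * x k l * x i j + reversal_defect i j k l m t.
Proof.
have := relx i j k l m t; rewrite /ajts_rel /kd -!natrM !mulnb !scaler_nat.
move/eqP; rewrite addr_eq0 !subr_eq => /eqP ->.
by rewrite addrC [- _ + _]addrC.
Qed.

(** Both sides are the cost of rearranging a b c d into c d a b, where a, b, c, d
    are the generators of indices a1 a2, b1 b2, c1 c2, d1 d2: on the left a b c and
    then b a d are reversed, on the right b c d and then a d c.  The quartic
    words cancel, which leaves a relation of degree two. *)
Lemma overlap a1 a2 b1 b2 c1 c2 d1 d2 :
  reversal_defect a1 a2 b1 b2 c1 c2 * x d1 d2
    + x c1 c2 * reversal_defect b1 b2 a1 a2 d1 d2 =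
  x a1 a2 * reversal_defect b1 b2 c1 c2 d1 d2
    + reversal_defect a1 a2 d1 d2 c1 c2 * x b1 b2.
Proof.
move: (mul_reverse a1 a2 b1 b2 c1 c2) (mul_reverse b1 b2 a1 a2 d1 d2).
move: (mul_reverse b1 b2 c1 c2 d1 d2) (mul_reverse a1 a2 d1 d2 c1 c2).
move: (x a1 a2) (x b1 b2) (x c1 c2) (x d1 d2) => a b c d.
do 4!move: (reversal_defect _ _ _ _ _ _) => ?.
move=> bcd adc abc bad.
apply: (addrI (c * d * a * b)); transitivity (a * b * c * d).
  by rewrite abc mulrDl -!(mulrA c) bad mulrDr !mulrA addrA addrAC.
by rewrite -!(mulrA a) bcd mulrDr !mulrA adc mulrDl addrA addrAC.
Qed.

Let two_cancel (u : A) : u *+ 2 = 0 -> u = 0.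
Proof.
by move=> /eqP; rewrite -scaler_nat scaler_eq0 (negbTE two_neq0) => /eqP.
Qed.

(** Evaluates the Kronecker symbols in an instance of the overlap relation, given
    the inequalities between its indices as rewriting rules. *)
Ltac simpl_defect neqs :=
  rewrite /reversal_defect !eqxx ?neqs /= ?andbF
    ?(mulr0n, mulr1n, subr0, sub0r, mulr0, mul0r, addr0, add0r, mulNr, mulrN,
      oppr0, opprK).

(** The overlap is applied to a factorisation of one of the two matrix units into
    three.  For two diagonal generators, and for the square of an off-diagonal one,
    the instance used contains the product twice, and 2 is cancelled. *)
Lemma mul_disjoint (i j k l : 'I_n) : j != k -> i != l -> x i j * x k l = 0.
Proof.
move=> jk il; have [kj li] : k != j /\ l != i by split; rewrite eq_sym.
case: (eqVneq i j) jk kj => [<-|ij] jk kj;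
  last have ji : j != i by rewrite eq_sym.
  case: (eqVneq k l) il li => [<-|kl] il li;
    last have lk : l != k by rewrite eq_sym.
    have := overlap i k k i i i k k.
    simpl_defect (negbTE li, negbTE il).
    by rewrite -mulr2n => /two_cancel.
  (* The second factor is off the diagonal: E_kl = E_kk E_kl E_ll. *)
  have := overlap k l k k i i l l.
  simpl_defect (negbTE li, negbTE il, negbTE jk, negbTE kj, negbTE kl,
    negbTE lk).
  by [].
case: (boolP ((i == k) && (l == j))) => [/andP[/eqP<- /eqP->]|ikjl].
  have := overlap i j i j j j j j.
  simpl_defect (negbTE ij, negbTE ji).
  by move/esym; rewrite -mulr2n => /two_cancel.
(* The first factor is off the diagonal: E_ij = E_ii E_ij E_jj. *)
have := overlap i i i j j j k l.
simpl_defect (negbTE ikjl, negbTE li, negbTE il, negbTE jk, negbTE kj,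
  negbTE ij, negbTE ji).
by [].
Qed.

(** Here E_ij E_jl = E_il while E_jl E_ij = 0; the product E_ii E_ij E_jj E_jl,
    bracketed at either end, moves the middle index to i. *)
Lemma mul_path_indep (i j l : 'I_n) : i != l -> x i j * x j l = x i i * x i l.
Proof.
move=> il; have li : l != i by rewrite eq_sym.
have [<-//|ij] := eqVneq i j; have ji : j != i by rewrite eq_sym.
have := overlap i i i j j j j l.
simpl_defect (negbTE li, negbTE il, negbTE ij, negbTE ji).
by [].
Qed.

(** The mirror image of mul_path_indep: the second factor times the first is the
    nonzero product E_ki E_ij = E_kj. *)
Lemma mul_copath_indep (i j k : 'I_n) : j != k -> x i j * x k i = x j j * x k j.
Proof.
move=> jk; have kj : k != j by rewrite eq_sym.
have [->//|ij] := eqVneq i j; have ji : j != i by rewrite eq_sym.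
have := overlap j j i j i i k i.
simpl_defect (negbTE kj, negbTE jk, negbTE ij, negbTE ji).
by move/oppr_inj.
Qed.

(** When i = l and j = k both orders of multiplication survive, and e_ij e_ji
    should be a term depending on i plus a term depending on j; this is the
    resulting compatibility. *)
Lemma mul_loops (i k : 'I_n) : i != k ->
  x i i * x i i + x k k * x k k = x i k * x k i + x k i * x i k.
Proof.
move=> ik; have ki : k != i by rewrite eq_sym.
have := overlap i k k k k i i i.
simpl_defect (negbTE ik, negbTE ki).
by move/eqP; rewrite subr_eq addrAC -subr_eq opprK => /eqP.
Qed.

(** * Products with a diagonal generator *)

Section Corner.

Variable o : 'I_n.
Local Notation e := (x o o).

(** The product x o k * x i o does not depend on the index o, which can be moved
    away to k, where e annihilates it. *)
Lemma row_col_mul0 (k i : 'I_n) : k != i -> k != o -> e * (x o k * x i o) = 0.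
Proof.
move=> ki ko; rewrite (mul_copath_indep _ ki) mulrA mul_disjoint ?mul0r //.
all: by rewrite eq_sym.
Qed.

Lemma row_row_mul0 (k j : 'I_n) : k != o -> e * (x o k * x o j) = 0.
Proof.
move=> ko; have [->|jo] := eqVneq j o; first exact: row_col_mul0.
by rewrite mul_disjoint ?mulr0 // eq_sym.
Qed.

Lemma col_mul_corner0 (i : 'I_n) : i != o -> e * (x i o * e) = 0.
Proof.
move=> io; rewrite (mul_path_indep _ io) mulrA mul_disjoint ?mul0r //.
all: by rewrite eq_sym.
Qed.

Lemma corner_col (k : 'I_n) : k != o -> e * x k o = x k o * x k k.
Proof. by move=> ko; rewrite (mul_copath_indep k) // eq_sym. Qed.

Lemma col_row_mul0 (i j : 'I_n) : i != o -> i != j -> e * (x i o * x o j) = 0.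
Proof.
by move=> io ij; rewrite mulrA corner_col // -mulrA mul_disjoint ?mulr0.
Qed.

(** Reversing e * e * x o j inside e ^+ 3 * x o j gives the right-hand side plus
    e * x o j * e * e, which vanishes. *)
Lemma corner3_row (j : 'I_n) : j != o -> e ^+ 3 * x o j = e * x o j.
Proof.
move=> jo; have oj : o != j by rewrite eq_sym.
rewrite !exprS expr0 mulr1 -!mulrA [e * (e * x o j)]mulrA mul_reverse.
simpl_defect (negbTE jo).
by rewrite mulrDr !mulrA -(mulrA e) (row_col_mul0 jo jo) mul0r add0r.
Qed.

(** The sign is that of the product-reversing representations, the only ones in
    which e * x i o is not zero. *)
Lemma corner3_col (i : 'I_n) : i != o -> e ^+ 3 * x i o = - (e * x i o).
Proof.
move=> io; have oi : o != i by rewrite eq_sym.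
rewrite !exprS expr0 mulr1 -!mulrA [e * (e * x i o)]mulrA mul_reverse.
simpl_defect (negbTE oi).
by rewrite mulrDr mulrN !mulrA -(mulrA e) col_mul_corner0 // mul0r add0r.
Qed.

Section Transversal.

Variables (k : 'I_n) (ko : k != o).

(** This and the next lemma are a linear system for the two ways around the loop
    between o and k. *)
Lemma corner_loops_add :
  e * (x o k * x k o) + e * (x k o * x o k) = e ^+ 3.
Proof.
have ok : o != k by rewrite eq_sym.
rewrite -mulrDr -mul_loops // mulrDr [e * (x k k * _)]mulrA.
by rewrite (@mul_disjoint o o k k) // mul0r addr0 !exprS expr0 mulr1.
Qed.

(** Reversing the left-hand side gives x k o * x o k * e + e; moving the factor e in
    e * x k o * x o k to the right end, through x k k, gives the same
    cubic word. *)
Lemma corner_loops_sub :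
  e * (x o k * x k o) = e * (x k o * x o k) + e.
Proof.
have ok : o != k by rewrite eq_sym.
rewrite [in RHS]mulrA corner_col // -mulrA -(mul_copath_indep o ko) !mulrA.
have := mul_reverse o o o k k o.
by simpl_defect (negbTE ok, negbTE ko).
Qed.

Let half_sum (u v w : A) : u + v = w -> forall t, u = v + t ->
  u = 2%:R^-1 *: (w + t) /\ v = 2%:R^-1 *: (w - t).
Proof.
have halfK z : z = (2%:R^-1 : F) *: (z + z).
  by rewrite -mulr2n -scaler_nat scalerA mulVf // scale1r.
move=> <- t uE; split; first by rewrite -addrA -uE -halfK.
by rewrite uE (addrAC v) addrK -halfK.
Qed.

Lemma corner_row_col : e * (x o k * x k o) = 2%:R^-1 *: (e ^+ 3 + e).
Proof. by case: (half_sum corner_loops_add corner_loops_sub). Qed.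

Lemma corner_col_row : e * (x k o * x o k) = 2%:R^-1 *: (e ^+ 3 - e).
Proof. by case: (half_sum corner_loops_add corner_loops_sub). Qed.

(** Multiplication by e ^+ 2 negates e * (x k o * x o k), which is half of
    e ^+ 3 - e. *)
Lemma corner5 : e ^+ 5 = e.
Proof.
have : e ^+ 2 * (e ^+ 3 - e) = - (e ^+ 3 - e).
  apply: (@scalerI _ _ (2%:R^-1 : F)); first by rewrite invr_eq0.
  rewrite scalerAr scalerN -corner_col_row.
  by rewrite [LHS]mulrA -exprSr [LHS]mulrA corner3_col // mulNr mulrA.
rewrite mulrBr -exprD -exprSr opprB => /eqP.
by rewrite subr_eq subrK => /eqP.
Qed.

End Transversal.

End Corner.

End ReversalRelations.

(** * The six identities *)

Theorem proposition4p6 (F : closedFieldType) (charF : [pchar F] =i pred0)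
    (n : nat) (hn : (2 <= n)%N) :
  let e := @env_gen F n in
  let o := idx1 hn in
  let d := fun a b : 'I_n => kd F a b in
  let dc := fun a b : 'I_n => kdc F a b in
  let h : F := 2%:R^-1 in
  (* (1) *)
  (forall i j k : 'I_n,
     e o o ^+ 2 * e o k * e i j =
       d k i *: (d j o *: ((d k o + h * dc k o) *: e o o ^+ 4
                           + (h * dc k o) *: e o o ^+ 2)
                 + dc j o *: (e o o * e o j))
       - (dc k i * d j o * d k o) *: (e o o * e i o)) /\
  (* (2) *)
  (forall i j k : 'I_n,
     e o o ^+ 2 * e o k * (e i o * e o j) =
       (d k i * d j o * (d k o + h * dc k o)
        + h * dc k i * d k o * dc i o * d i j) *: e o o
       + (h * (d k i * dc k o * d j o - dc k i * d k o * dc i o * d i j))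
           *: e o o ^+ 3
       + (d k o * (d k i * dc j o - dc k i * d i o) + d k i * dc k o * dc j o)
           *: (e o o ^+ 2 * e o j)) /\
  (* (3) *)
  (forall i j k : 'I_n, (i, j) <> (o, o) ->
     e o o ^+ 2 * e o k * (e o i * e j o) =
       d k o *: (- (d i o *: (e o o ^+ 2 * e j o))
                 + (dc i o * d i j) *: (h *: (e o o ^+ 3 + e o o)))) /\
  (* (4) *)
  (forall j k l : 'I_n, l <> o ->
     e o o ^+ 2 * e o k * (e o j * e o o * e l o) =
       (d k o * d j o) *: (e o o * e l o)) /\
  (* (5) *)
  (forall j k : 'I_n,
     e o o ^+ 2 * e o k * (e o o ^+ 2 * e o j) = d k o *: (e o o * e o j)) /\
  (* (6) *)
  (forall j : 'I_n,
     e o o ^+ 2 * e o j * e o o ^+ 4 = d j o *: e o o ^+ 3).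
Proof.
have two_neq0 : 2%:R != 0 :> F by rewrite (pcharf0P F).1.
(* The relations are all that the argument uses; forgetting the quotient
   construction keeps rewriting from unfolding it. *)
have := @env_gen_rel F n.
move: (envelope F n) (@env_gen F n) => A x relx e o d dc h; rewrite /e {e}.
(* The fifth power is computed with the help of a second index. *)
have [k0 k0o] : exists k0, k0 != o.
  by exists (Ordinal hn); rewrite -val_eqE.
have e5 : x o o ^+ 5 = x o o by apply: (corner5 relx two_neq0 k0o).
have mul2 y : x o o ^+ 2 * y = x o o * (x o o * y) by rewrite expr2 mulrA.
have mul3 y : x o o ^+ 3 * y = x o o * (x o o * (x o o * y)).
  by rewrite !exprS expr0 mulr1 !mulrA.
have row_row0 k j : k != o -> x o o * (x o k * x o j) = 0.
  exact: row_row_mul0.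
have row_col0 k i : k != i -> k != o -> x o o * (x o k * x i o) = 0.
  exact: row_col_mul0.
have row3 j : j != o -> x o o ^+ 3 * x o j = x o o * x o j.
  exact: corner3_row.
have col3 i : i != o -> x o o ^+ 3 * x i o = - (x o o * x i o).
  exact: corner3_col.
have row_col k : k != o ->
    x o o * (x o k * x k o) = h *: (x o o ^+ 3 + x o o).
  exact: corner_row_col.
have col_row0 i j : i != o -> i != j -> x o o * (x i o * x o j) = 0.
  exact: col_row_mul0.
have col_row i : i != o ->
    x o o * (x i o * x o i) = h *: (x o o ^+ 3 - x o o).
  exact: corner_col_row.
have oN k : k != o -> o != k by rewrite eq_sym.
have halfD (y : A) : h *: y + h *: y = y.
  by rewrite -scalerDl -mulr2n -[h *+ 2]mulr_natr mulVf // scale1r.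
(* kdE evaluates scalars once the Kronecker symbols are numerals, scE the linear
   combinations they are coefficients of. *)
pose kdE := (subrr, subr0, sub0r, mulr0, mul0r, mulr1, mul1r, add0r, addr0,
  mulr0n, mulr1n, oppr0).
pose scE := (scale0r, scale1r, scaler0, oppr0, subr0, sub0r, addr0, add0r).
do 5?split.
- move=> i j k; rewrite /d /dc /kdc /kd.
  have [<-{i}|ki] := eqVneq k i; have [->{j}|jo] := eqVneq j o.
  + have [->{k}|ko] := eqVneq k o; rewrite ?kdE ?scE; first by rewrite -!exprSr.
    by rewrite -mulrA mul2 row_col // -scalerAr mulrDr scalerDr -exprS -expr2.
  + rewrite ?kdE ?scE -mulrA (mul_path_indep relx k (oN _ jo)) mulrA -exprSr.
    exact: row3.
  + have [ko|ko] := eqVneq k o; rewrite ?kdE ?scE.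
      by move: ki; rewrite ko eq_sym -exprSr => /col3.
    by rewrite -mulrA mul2 row_col0 ?mulr0.
  + by rewrite ?kdE ?scE -mulrA (mul_disjoint relx) ?mulr0 // oN.
- move=> i j k; rewrite /d /dc /kdc /kd.
  rewrite !mulrA -(mulrA _ (x o k)) mul2.
  have [<-{i}|ki] := eqVneq k i; have [ko|ko] := eqVneq k o.
  + rewrite ko; have [->{j}|jo] := eqVneq j o; rewrite ?kdE ?scE.
      by rewrite -expr2 -!exprS -exprSr e5.
    by rewrite -expr2 -!exprS exprS -mulrA row3 // mulrA -expr2.
  + rewrite row_col // -scalerAr -scalerAl mulrDr -expr2 -exprS.
    have [->{j}|jo] := eqVneq j o; rewrite ?kdE ?scE mulrDl.
      by rewrite -!exprSr e5 scalerDr.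
    by rewrite exprS -mulrA row3 // mulrA scalerDr halfD.
  + have io : i != o by rewrite -ko eq_sym.
    rewrite ko (negbTE io) !kdE -mul3 col3 // mulNr -mulrA.
    have [<-|ij] := eqVneq i j; rewrite ?kdE ?scE;
      last by rewrite col_row0 ?oppr0.
    by rewrite col_row // mulrN1 scaleNr -scalerBr -scalerN opprB.
  + by rewrite ?kdE ?scE row_col0 // mulr0 mul0r.
- move=> i j k ij; rewrite /d /dc /kdc /kd.
  have [->{k}|ko] := eqVneq k o; rewrite ?kdE ?scE; last first.
    by rewrite mulrA -(mulrA _ (x o k)) mul2 row_row0 // mulr0 mul0r.
  have [io|io] := eqVneq i o; rewrite ?kdE ?scE.
    have jo : j != o by apply/eqP => jo; apply: ij; rewrite io jo.
    by rewrite io -exprSr mulrA -exprSr exprS -mulrA col3 // mulrN mulrA.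
  have [<-|nij] := eqVneq i j; rewrite ?kdE ?scE -mulrA.
    rewrite row_col // -scalerAr mulrDr -exprD e5 -exprSr.
    by rewrite [x o o + _]addrC.
  by rewrite row_col0 ?mulr0.
- move=> j k l /eqP lo; rewrite /d /kd !mulrA.
  have [->{k}|ko] := eqVneq k o; rewrite ?kdE ?scE; last first.
    by rewrite -(mulrA _ (x o k)) mul2 row_row0 // mulr0 !mul0r.
  have [->{j}|jo] := eqVneq j o; rewrite ?kdE ?scE.
    by rewrite -!exprSr e5.
  rewrite -(mulrA _ (x o j)) -(mulrA _ (x o o) (_ * _)).
  by rewrite row_row0 // mulr0 mul0r.
- move=> j k; rewrite /d /kd.
  have [->{k}|ko] := eqVneq k o; rewrite ?kdE ?scE.
    by rewrite -exprSr mulrA -exprD e5.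
  rewrite [_ ^+ 2 * x o j]mul2 mulrA -(mulrA _ (x o k)) -mulrA mul2 !mulrA.
  rewrite -(mulrA _ (x o k)) -(mulrA _ (x o o) (_ * _)).
  by rewrite row_row0 // mulr0 !mul0r.
- move=> j; rewrite /d /kd.
  have [->{j}|jo] := eqVneq j o; rewrite ?kdE ?scE.
    by rewrite -exprSr -exprD -[(3 + 4)%N]/(5 + 2)%N exprD e5 -exprS.
  rewrite [_ ^+ 4]exprS mulrA -(mulrA _ (x o j)) mul2.
  by rewrite row_row0 // mulr0 mul0r.
Qed.
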